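(* The diagram formed by the maps $\iota:\mathrm{Tridend}(\mathbb{N}^* )\to\mathrm{Tree}(\mathbb{N}^* )$, $\mathrm{flat}:\mathrm{Tree}(\mathbb{N}^* )\to\mathcal{W}_{\mathbb{N}^*}$, $\Psi:\mathrm{Tridend}(\mathbb{N}^* )\to\mathcal{W}_{\mathbb{N}^*}$, $\zeta_{\mathrm{FS}}:\mathcal{W}_{\mathbb{N}^*}\to\mathcal{S}_{\mathbb{N}^*}$ and $\zeta^{\mathrm{Tri}}:\mathrm{Tridend}(\mathbb{N}^* )\to\mathcal{S}_{\mathbb{N}^*}$ commutes; that is, $$\mathrm{flat}\circ\iota=\Psi\qquad\text{and}\qquad \zeta_{\mathrm{FS}}\circ\Psi=\zeta^{\mathrm{Tri}}.$$
   Context: All vector spaces are over $\mathbb{R}$; $\mathbb{N}^*=\{1,2,\dots\}$. **Tridendriform algebras.** A tridendriform algebra is a vector space $A$ with bilinear operations $\prec,\cdot,\succ$ such that, with $x*y:=x\prec y+x\cdot y+x\succ y$, for all $x,y,z\in A$: $(x\prec y)\prec z=x\prec(y*z)$; $(x\succ y)\prec z=x\succ(y\prec z)$; $(x*y)\succ z=x\succ(y\succ z)$; $(x\succ y)\cdot z=x\succ(y\cdot z)$; $(x\prec y)\cdot z=x\cdot(y\succ z)$; $(x\cdot y)\prec z=x\cdot(y\prec z)$; $(x\cdot y)\cdot z=x\cdot(y\cdot z)$. ''Tridendriform algebra'' always means the augmented one $\overline A=A\oplus\mathbb{R}1$, with $1\prec a=0=a\succ1$, $a\prec1=a=1\succ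 a$, $a\cdot1=0=1\cdot a$ for $a\in A$ (and $1*1=1$). A morphism is a linear map sending $1$ to $1$, $A$ to $B$, and preserving $\prec,\succ,\cdot$ on $A$. **Words.** $\mathcal{W}_{\mathbb{N}^*}$ has basis the finite words on $\mathbb{N}^*$, unit the empty word $\emptyset$. The quasi-shuffle $\star_q$ is defined by $u\star_q\emptyset=\emptyset\star_q u=u$ and, for nonempty $u=u_1\cdots u_n$, $v=v_1\cdots v_k$, $u\star_q v=u\prec v+u\succ v+u\cdot v$ with $u\prec v=u_1(u_2\cdots u_n\star_q v)$, $u\succ v=v_1(u\star_q v_2\cdots v_k)$, $u\cdot v=(u_1+v_1)(u_2\cdots u_n\star_q v_2\cdots v_k)$. It is a tridendriform algebra. **Quasi-shuffles.** For $k,l\ge1$, $\mathrm{Qsh}(k,l)$ is the set of surjections $\sigma:\{1,\dots,k+l\}\to\{1,\dots,n\}$ (some $n=\max(\sigma)$) with $\sigma(1)<\dots<\sigma(k)$ and $\sigma(k+1)<\dots<\sigma(k+l)$. **Formal series.** For $d\in\mathbb{N}$, $\mathbb{R}\mathcal{P}(\mathbb{N}^d)$ is the vector space with basis the power set of $\mathbb{N}^d$, an algebra for $\cup$, and $J_d$ its ideal generated by all $A\cup B-A-B+A\cap B$. Fix $F:k\mapsto f_k=(n\mapsto n^{-k})$. A formal series $A\otimes w\times F$, also written $\sum_A\prod_i f_{w_i}$, is a pair consisting of an element of $\langle(\mathbb{R}\mathcal{P}(\mathbb{N}^{\ell(w)})/J_{\ell(w)})\otimes w\mid w\text{ a word}\rangle$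 ($\ell$ = length) and of $F$; vector space operations are those of the first component. $\mathcal{S}_{\mathbb{N}^*}$ is the span of all $\sum_{1\le n_r<\dots<n_1}\prod_{i=1}^r f_{\omega_i}:=\{(n_1,\dots,n_r):1\le n_r<\dots<n_1\}\otimes\omega_1\cdots\omega_r\times F$, $r\ge0$ (for $r=0$: $\emptyset\otimes\emptyset\times F$, the unit). For $\alpha=\sum_{1\le n_k<\dots<n_1}\prod_{i=1}^k f_{\omega_i}$, $\beta=\sum_{1\le n_{k+l}<\dots<n_{k+1}}\prod_{i=k+1}^{k+l}f_{\omega_i}$ ($k,l\ge1$), each of $\alpha\prec\beta,\alpha\succ\beta,\alpha\cdot\beta$ is $\sum_\sigma\sum_{1\le n_{\max(\sigma)}<\dots<n_1}\prod_i f_{\omega_{\sigma^{-1}(\{i\})}}$ over $\sigma\in\mathrm{Qsh}(k,l)$ with, respectively, $\sigma^{-1}(\{1\})=\{1\},\{k+1\},\{1,k+1\}$, where $\omega_{\{i\}}=\omega_i$ and $\omega_{\{i,j\}}=\omega_i+\omega_j$. It is a tridendriform algebra. $\zeta_{\mathrm{FS}}$ is the linear map $\omega_1\cdots\omega_k\mapsto\sum_{1\le n_k<\dots<n_1}\prod_{i=1}^k f_{\omega_i}$, $\emptyset\mapsto\emptyset\otimes\emptyset\times F$. **Schroeder trees.** A Schroeder tree is a planar rooted tree each of whose internal (non-leaf) vertices has at least two children; $|$ is the tree with no internal vertex. An angle of an internal vertex $v$ is a pair of consecutive (left to right) edges from $v$ to its children. $\nu(t)$ is the set of internal vertices of $t$,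 $\mathrm{Ang}(v)$ the set of angles of $v$. $\mathrm{Tridend}(\mathbb{N}^* )$ is the vector space with basis the Schroeder trees with all angles decorated by elements of $\mathbb{N}^*$. $Y_n$ denotes the tree with one internal vertex, two leaves, angle decorated by $n$. **Products on $\mathrm{Tridend}(\mathbb{N}^* )$.** For trees $t,s\neq|$, let $v_1$ (the root), $\dots,v_k$ be the internal vertices on the rightmost branch of $t$, $F_i$ the ordered forest of subtrees at all children of $v_i$ except the rightmost one, $w_i$ the word of decorations of the angles of $v_i$; let $v_{k+1}$ (the root), $\dots,v_{k+l}$ be the internal vertices on the leftmost branch of $s$, $F_{k+i}$ the forest of subtrees at all children of $v_{k+i}$ except the leftmost one, $w_{k+i}$ the word of its angle decorations. For $\sigma\in\mathrm{Qsh}(k,l)$ with image $\{1,\dots,n\}$, $\sigma(t,s)$ is obtained from the ladder with nodes $1$ (root), $\dots,n$, ended above by a leaf, by grafting $F_i$ to the left of the ladder at node $\sigma(i)$ for $i\le k$ and $F_i$ to the right at node $\sigma(i)$ for $i>k$, keeping decorations of the $F_i$, and decorating the angles of node $m$ left to right by $w_i$ if $\sigma^{-1}(\{m\})=\{i\}$ and by the concatenation $w_iw_j$ if $\sigma^{-1}(\{m\})=\{i,j\}$, $i\le k<j$. Then $t\prec s$, $t\succ s$, $t\cdot s$ are the sums of $\sigma(t,s)$ over $\sigma\in\mathrm{Qsh}(k,l)$ with $\sigma^{-1}(\{1\})=\{1\}$, $\{k+1\}$, $\{1,k+1\}$ respectively; $|$ is the unit. It is known that $\mathrm{Tridend}(\mathbb{N}^*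 )$ is the free tridendriform algebra on $\mathbb{N}^*$ via $n\mapsto Y_n$: any map from $\mathbb{N}^*$ to a tridendriform algebra extends uniquely to a morphism. **Maps.** $\Psi$ is the unique tridendriform morphism with $\Psi(Y_n)=n$ (one-letter word). $\zeta^{\mathrm{Tri}}$ is the unique tridendriform morphism with $\zeta^{\mathrm{Tri}}(Y_n)=\sum_{1\le k}f_n$. $\mathrm{Tree}(\mathbb{N}^* )$ is the vector space with basis the Schroeder trees whose internal vertices $v$ are decorated by elements of $\mathbb{N}^*$ that are at least the number of angles of $v$. $\iota$ is the linear map keeping the tree and decorating each internal vertex by the sum of the decorations of its angles. $\mathrm{flat}$ is the linear map with $\mathrm{flat}(|)=\emptyset$ and, for $t$ with root decorated by $n$ and subtrees $t_1,\dots,t_k$ at the children of the root, $\mathrm{flat}(t)=n(\mathrm{flat}(t_1)\star_q\cdots\star_q\mathrm{flat}(t_k))$ (letter $n$ followed by each word). *)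

(* Defs.v *)
From HB Require Import structures.
From mathcomp Require Import all_boot all_order all_algebra finmap.
From mathcomp Require Import generic_quotient ring_quotient.
From mathcomp Require Import boolp classical_sets cardinality reals.
From mathcomp.multinomials Require Import monalg.

Set Implicit Arguments.
Unset Strict Implicit.
Unset Printing Implicit Defensive.

Import GRing.Theory Num.Theory.

Local Open Scope ring_scope.

Definition posnat := {n : nat | (0 < n)%N}.

HB.instance Definition _ := Countable.on posnat.

Definition pone : posnat := exist (fun n => is_true (0 < n)%N) 1%N isT.

Fact padd_subproof (m n : posnat) : (0 < val m + val n)%N.
Proof. by rewrite addn_gt0 (valP m). Qed.

Definition padd (m n : posnat) : posnat :=
  exist (fun n => is_true (0 < n)%N) (val m + val n)%N (padd_subproof m n).

(* The sum of the nonempty word [a :: s]. *)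
Definition psum (a : posnat) (s : seq posnat) : posnat := foldr padd a s.

Lemma leq_size_psum a s : (size s < val (psum a s))%N.
Proof.
elim: s => [|b s IHs]; first exact: (valP a).
by rewrite /= -[(size s).+1]add1n -addnS leq_add // (valP b).
Qed.

Section LinExt.
Variables (R : realType) (B : choiceType) (V : lmodType R).

Definition lin_ext (f : B -> V) (x : {malg R[B]}) : V :=
  \sum_(b <- msupp x) x@_b *: f b.

Definition bilin_ext (f : B -> B -> V) (x y : {malg R[B]}) : V :=
  lin_ext (fun b => lin_ext (f b) y) x.

Lemma lin_extEw (f : B -> V) (d : {fset B}) (x : {malg R[B]}) :
  (msupp x `<=` d)%fset -> lin_ext f x = \sum_(b <- d) x@_b *: f b.
Proof.
move=> le; rewrite /lin_ext (big_fset_incl _ le) // => b _ /mcoeff_outdom ->.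
by rewrite scale0r.
Qed.

Fact lin_ext_is_linear (f : B -> V) : linear (lin_ext f).
Proof.
move=> c x y.
pose d := (msupp x `|` msupp y `|` msupp (c *: x + y))%fset.
have lx : (msupp x `<=` d)%fset by rewrite /d -fsetUA fsubsetUl.
have ly : (msupp y `<=` d)%fset.
  by rewrite /d [(msupp x `|` _)%fset]fsetUC -fsetUA fsubsetUl.
have lxy : (msupp (c *: x + y) `<=` d)%fset by rewrite /d fsubsetUr.
rewrite (lin_extEw f lx) (lin_extEw f ly) (lin_extEw f lxy).
rewrite scaler_sumr -big_split /=; apply: eq_bigr => b _.
by rewrite mcoeffD mcoeffZ scalerDl scalerA.
Qed.

HB.instance Definition _ (f : B -> V) :=
  GRing.isLinear.Build R {malg R[B]} V *:%R (lin_ext f) (lin_ext_is_linear f).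

Lemma lin_extU (f : B -> V) (b : B) : lin_ext f << b >> = f b.
Proof.
rewrite (@lin_extEw f [fset b]%fset) ?msuppU_le // big_seq_fset1.
by rewrite mcoeffUU scale1r.
Qed.

Lemma bilin_extU (f : B -> B -> V) (b b' : B) :
  bilin_ext f << b >> << b' >> = f b b'.
Proof. by rewrite /bilin_ext !lin_extU. Qed.

End LinExt.

(* [tspace] is the augmented space A + R1 and [taug] is A.  Being a morphism
   only involves these data, so the seven axioms are not recorded. *)
Record tridend_data (R : realType) := TridendData {
  tspace :> lmodType R;
  tone : tspace;
  taug : set tspace;
  tprec : tspace -> tspace -> tspace;
  tdot : tspace -> tspace -> tspace;
  tsucc : tspace -> tspace -> tspace }.

Record tridend_morphism (R : realType) (A B : tridend_data R)
    (f : {linear A -> B}) : Prop := TridendMorphism {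
  tmorph1 : f (tone A) = tone B;
  tmorph_aug : forall x, taug x -> taug (f x);
  tmorph_prec : forall x y, taug x -> taug y ->
    f (tprec x y) = tprec (f x) (f y);
  tmorph_dot : forall x y, taug x -> taug y ->
    f (tdot x y) = tdot (f x) (f y);
  tmorph_succ : forall x y, taug x -> taug y ->
    f (tsucc x y) = tsucc (f x) (f y) }.

(* An augmented tridendriform structure on a space [V] with basis [e],
   given by operations on the basis of A (the [e b] with [b != b0]), the
   unit being [e b0].  [coord] gives the coordinates in the basis [e].
   The products [1 < 1] and [1 > 1] are undefined; they are set to 0. *)
Section Based.
Variables (R : realType) (B : choiceType) (V : lmodType R).
Variables (e : B -> V) (coord : V -> {malg R[B]}) (b0 : B).
Variables (prec dot succ : B -> B -> V).

Definition aug_prec (u v : B) : V :=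
  if u == b0 then 0 else if v == b0 then e u else prec u v.

Definition aug_dot (u v : B) : V :=
  if (u == b0) || (v == b0) then 0 else dot u v.

Definition aug_succ (u v : B) : V :=
  if v == b0 then 0 else if u == b0 then e v else succ u v.

Definition aug_ideal : set V :=
  [set x | exists2 c : {malg R[B]}, c@_b0 = 0 & x = lin_ext e c].

Definition based_tridend : tridend_data R := {|
  tspace := V;
  tone := e b0;
  taug := aug_ideal;
  tprec := fun x y => bilin_ext aug_prec (coord x) (coord y);
  tdot := fun x y => bilin_ext aug_dot (coord x) (coord y);
  tsucc := fun x y => bilin_ext aug_succ (coord x) (coord y) |}.

End Based.

Definition word := seq posnat.

HB.instance Definition _ := Countable.on word.

Section Words.
Variable R : realType.
Local Notation W := {malg R[word]}.

Definition wcons (a : posnat) : W -> W := lin_ext (fun w : word => << a :: w >>).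

HB.instance Definition _ a := GRing.Linear.on (wcons a).

Fixpoint qshuffle (u : word) : word -> W :=
  match u with
  | [::] => fun v => << v >>
  | a :: u' =>
      fix qshuffle_u (v : word) : W :=
        match v with
        | [::] => << u >>
        | b :: v' => wcons a (qshuffle u' v) + wcons b (qshuffle_u v')
                     + wcons (padd a b) (qshuffle u' v')
        end
  end.

Definition word_prec (u v : word) : W :=
  if u is a :: u' then wcons a (qshuffle u' v) else 0.

Definition word_succ (u v : word) : W :=
  if v is b :: v' then wcons b (qshuffle u v') else 0.

Definition word_dot (u v : word) : W :=
  match u, v with
  | a :: u', b :: v' => wcons (padd a b) (qshuffle u' v')
  | _, _ => 0
  end.

Lemma qshuffleE (u v : word) : u != [::] -> v != [::] ->
  qshuffle u v = word_prec u v + word_succ u v + word_dot u v.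
Proof. by case: u v => [|a u] [|b v]. Qed.

Definition star : W -> W -> W := bilin_ext qshuffle.

Definition word_tridend : tridend_data R :=
  based_tridend (fun w : word => << w >> : W) id [::]
    word_prec word_dot word_succ.

End Words.

(* Indices start at 0; [lshift l i] and [rshift k j] are the elements of the
   first and of the second block. *)
Section Qsh.
Variables k l : nat.

Definition is_qsh n (s : {ffun 'I_(k + l) -> 'I_n}) : bool :=
  [&& [forall m, [exists i, s i == m]],
      [forall i : 'I_k, [forall j : 'I_k,
         (i < j)%N ==> (s (lshift l i) < s (lshift l j))%N]] &
      [forall i : 'I_l, [forall j : 'I_l,
         (i < j)%N ==> (s (rshift k i) < s (rshift k j))%N]]].

(* The preimage of the first element of the image is [C]. *)
Definition fibre0 (C : pred nat) n (s : {ffun 'I_(k + l) -> 'I_n}) : bool :=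
  [forall i, (s i == 0 :> nat) == C i].

Definition qsh_sum (V : nmodType) (C : pred nat)
    (F : forall n, {ffun 'I_(k + l) -> 'I_n} -> V) : V :=
  \sum_(n < (k + l).+1)
    \sum_(s : {ffun 'I_(k + l) -> 'I_n} | is_qsh s && fibre0 C s) F n s.

Definition qsh_prec (V : nmodType) := @qsh_sum V (pred1 0%N).
Definition qsh_succ (V : nmodType) := @qsh_sum V (pred1 k).
Definition qsh_dot (V : nmodType) := @qsh_sum V (pred2 0%N k).

Definition left_at n (s : {ffun 'I_(k + l) -> 'I_n}) (m : 'I_n) :
    option 'I_k := [pick i | s (lshift l i) == m].

Definition right_at n (s : {ffun 'I_(k + l) -> 'I_n}) (m : 'I_n) :
    option 'I_l := [pick j | s (rshift k j) == m].

End Qsh.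

(* The last case does not occur when [s] is surjective. *)
Definition qsh_letter (u v : word) n
    (s : {ffun 'I_(size u + size v) -> 'I_n}) (m : 'I_n) : posnat :=
  match left_at s m, right_at s m with
  | Some i, None => tnth (in_tuple u) i
  | None, Some j => tnth (in_tuple v) j
  | Some i, Some j => padd (tnth (in_tuple u) i) (tnth (in_tuple v) j)
  | None, None => pone
  end.

Definition qsh_word (u v : word) n
    (s : {ffun 'I_(size u + size v) -> 'I_n}) : word :=
  [seq qsh_letter s m | m <- enum 'I_n].

Definition subsets (d : nat) := set (d.-tuple nat).

HB.instance Definition _ d := Choice.on (subsets d).

Fact setU_unit d (A B : subsets d) :
  (A `|` B)%classic = set0 -> A = set0 /\ B = set0.
Proof. by rewrite setU_eq0. Qed.

HB.instance Definition _ d := Choice_isMonomialDef.Build (subsets d)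
  (@setUA _) (@set0U _) (@setU0 _) (@setU_unit d).
HB.instance Definition _ d :=
  MonomialDef_isConomialDef.Build (subsets d) (@setUC _).

Section PowerSetQuotient.
Variables (R : realType) (d : nat).
Local Notation RP := {malg R[subsets d]}.

Definition modular_rel (A B : subsets d) : RP :=
  << ((A `|` B)%classic : subsets d) >> - << A >> - << B >>
  + << ((A `&` B)%classic : subsets d) >>.

Definition Jd : {pred RP} := fun x =>
  `[< exists s : seq (RP * (subsets d * subsets d)),
        x = \sum_(p <- s) p.1 * modular_rel p.2.1 p.2.2 >].

(* Every subset has image 1 under this character, which kills J_d. *)
Definition cst1 (_ : subsets d) : R := 1.

Fact cst1_mmorphism : mmorphism cst1.
Proof. by split=> // A B; rewrite /cst1 mulr1. Qed.

HB.instance Definition _ :=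
  isMultiplicative.Build (subsets d) R cst1 cst1_mmorphism.

Definition total_mass : RP -> R := mmap idfun cst1.

HB.instance Definition _ := GRing.RMorphism.on total_mass.
HB.instance Definition _ := GRing.Linear.on total_mass.

Lemma total_massU (A : subsets d) : total_mass << A >> = 1.
Proof. by rewrite /total_mass mmapU mulr1. Qed.

Lemma total_mass_Jd x : x \in Jd -> total_mass x = 0.
Proof.
move=> /asboolP[s ->]; rewrite rmorph_sum big1 // => p _.
by rewrite rmorphM rmorphD !rmorphB /= !total_massU subrr sub0r addNr mulr0.
Qed.

Fact Jd_idealr_closed : idealr_closed Jd.
Proof.
split.
- by apply/asboolP; exists [::]; rewrite big_nil.
- by apply/negP => /total_mass_Jd /eqP; rewrite rmorph1 oner_eq0.
- move=> a _ _ /asboolP[s ->] /asboolP[s' ->]; apply/asboolP.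
  exists ([seq (a * p.1, p.2) | p <- s] ++ s').
  rewrite big_cat big_map mulr_sumr /=; congr (_ + _).
  by apply: eq_bigr => p _; rewrite mulrA.
Qed.

HB.instance Definition _ := isIdealr.Build RP Jd Jd_idealr_closed.

Definition RPJ := {ideal_quot Jd}.

HB.instance Definition _ := GRing.ComNzRing.on RPJ.

Definition RPJ_class (x : RP) : RPJ := \pi_({ideal_quot Jd})%qT x.

Fact RPJ_class_is_zmod_morphism : zmod_morphism RPJ_class.
Proof. by move=> x y; rewrite /RPJ_class !piE. Qed.

HB.instance Definition _ :=
  GRing.isZmodMorphism.Build RP RPJ RPJ_class RPJ_class_is_zmod_morphism.

Lemma RPJ_eq x y : (RPJ_class x == RPJ_class y) = (x - y \in Jd).
Proof. by rewrite Quotient.idealrBE. Qed.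

Definition RPJ_scale (c : R) (q : RPJ) : RPJ := RPJ_class (c *: repr q).

Lemma RPJ_classZ c x : RPJ_class (c *: x) = RPJ_scale c (RPJ_class x).
Proof.
apply/eqP; rewrite RPJ_eq -scalerBr -mul_malgC idealMr // -RPJ_eq.
by rewrite /RPJ_class reprK.
Qed.

Lemma RPJ_classP q : exists x, q = RPJ_class x.
Proof. by exists (repr q); rewrite /RPJ_class reprK. Qed.

Fact RPJ_scaleA c c' q : RPJ_scale c (RPJ_scale c' q) = RPJ_scale (c * c') q.
Proof. by have [x ->] := RPJ_classP q; rewrite -!RPJ_classZ scalerA. Qed.

Fact RPJ_scale1 : left_id 1 RPJ_scale.
Proof. by move=> q; have [x ->] := RPJ_classP q; rewrite -!RPJ_classZ scale1r. Qed.

Fact RPJ_scaleDr : right_distributive RPJ_scale +%R.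
Proof.
move=> c p q; have [x ->] := RPJ_classP p; have [y ->] := RPJ_classP q.
by rewrite -raddfD -!RPJ_classZ scalerDr raddfD.
Qed.

Fact RPJ_scaleDl q : {morph RPJ_scale^~ q : c c' / c + c'}.
Proof.
move=> c c'; have [x ->] := RPJ_classP q.
by rewrite -!RPJ_classZ scalerDl raddfD.
Qed.

HB.instance Definition _ := GRing.Zmodule_isLmodule.Build R RPJ
  RPJ_scaleA RPJ_scale1 RPJ_scaleDr RPJ_scaleDl.

HB.instance Definition _ :=
  GRing.isScalable.Build R RP RPJ *:%R RPJ_class RPJ_classZ.

End PowerSetQuotient.

Section DirectSum.
Variables (R : nzRingType) (I : choiceType) (V : I -> lmodType R).

Definition dprod := forall i, V i.

HB.instance Definition _ := gen_eqMixin dprod.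
HB.instance Definition _ := gen_choiceMixin dprod.

Implicit Types x y z : dprod.

Definition dprod_zero : dprod := fun i => 0.
Definition dprod_opp x : dprod := fun i => - x i.
Definition dprod_add x y : dprod := fun i => x i + y i.
Definition dprod_scale (c : R) x : dprod := fun i => c *: x i.

Fact dprod_addA : associative dprod_add.
Proof. by move=> x y z; apply: functional_extensionality_dep => i; exact: addrA. Qed.
Fact dprod_addC : commutative dprod_add.
Proof. by move=> x y; apply: functional_extensionality_dep => i; exact: addrC. Qed.
Fact dprod_add0 : left_id dprod_zero dprod_add.
Proof. by move=> x; apply: functional_extensionality_dep => i; exact: add0r. Qed.
Fact dprod_addN : left_inverse dprod_zero dprod_opp dprod_add.
Proof. by move=> x; apply: functional_extensionality_dep => i; exact: addNr. Qed.

HB.instance Definition _ := GRing.isZmodule.Build dprod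
  dprod_addA dprod_addC dprod_add0 dprod_addN.

Fact dprod_scaleA c c' x :
  dprod_scale c (dprod_scale c' x) = dprod_scale (c * c') x.
Proof. by apply: functional_extensionality_dep => i; exact: scalerA. Qed.
Fact dprod_scale1 : left_id 1 dprod_scale.
Proof. by move=> x; apply: functional_extensionality_dep => i; exact: scale1r. Qed.
Fact dprod_scaleDr : right_distributive dprod_scale +%R.
Proof. by move=> c x y; apply: functional_extensionality_dep => i; exact: scalerDr. Qed.
Fact dprod_scaleDl x : {morph dprod_scale^~ x : c c' / c + c'}.
Proof. by move=> c c'; apply: functional_extensionality_dep => i; exact: scalerDl. Qed.

HB.instance Definition _ := GRing.Zmodule_isLmodule.Build R dprod
  dprod_scaleA dprod_scale1 dprod_scaleDr dprod_scaleDl.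

Definition finite_supp : {pred dprod} :=
  fun x => `[< finite_set [set i | x i != 0]%classic >].

Fact finite_supp_submod : submod_closed finite_supp.
Proof.
split=> [|c x y /asboolP fx /asboolP fy]; apply/asboolP.
  by rewrite (_ : [set i | _]%classic = set0) // -subset0 => i /=; rewrite eqxx.
apply: (@sub_finite_set _ _
  ([set i | x i != 0] `|` [set i | y i != 0])%classic); last first.
  by rewrite finite_setU.
move=> i /=; rewrite -[(c *: x + y) i]/(c *: x i + y i).
by have [->|nx _] := eqVneq (x i) 0; [rewrite scaler0 add0r; right | left].
Qed.

HB.instance Definition _ :=
  GRing.isSubmodClosed.Build R dprod finite_supp finite_supp_submod.

Definition dsum := {x : dprod | finite_supp x}.

HB.instance Definition _ := SubChoice.on dsum.
HB.instance Definition _ := [SubChoice_isSubLmodule of dsum by <:].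

Definition dsum_coord (i : I) (x : dsum) : V i := val x i.

Fact dsum_coord_is_linear i : linear (@dsum_coord i).
Proof. by []. Qed.

HB.instance Definition _ i := GRing.isLinear.Build R dsum (V i) *:%R
  (@dsum_coord i) (@dsum_coord_is_linear i).

Definition dprod_single (i : I) (v : V i) : dprod := fun j =>
  if i =P j is ReflectT e then ecast k (V k) e v else 0.

Fact dprod_single_supp i (v : V i) : finite_supp (dprod_single v).
Proof.
apply/asboolP/(@sub_finite_set _ _ [set i]%classic) => // j /=.
by rewrite /dprod_single; case: eqP => [e _|_ /eqP]; first exact: esym.
Qed.

Definition dsum_single (i : I) (v : V i) : dsum :=
  exist finite_supp (dprod_single v) (dprod_single_supp v).

Lemma dsum_singleK i (v : V i) : dsum_coord i (dsum_single v) = v.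
Proof.
rewrite /dsum_coord /= /dprod_single; case: eqP => // e.
by rewrite (eq_irrelevance e (erefl i)).
Qed.

Lemma dsum_single_neq i j (v : V i) : i != j ->
  dsum_coord j (dsum_single v) = 0.
Proof. by rewrite /dsum_coord /= /dprod_single; case: eqP. Qed.

End DirectSum.

Section FormalSeries.
Variable R : realType.

(* f_k = (n |-> n^-k); the value at n = 0 is irrelevant. *)
Definition inv_pow (k : posnat) (n : nat) : R := n%:R ^- val k.

Local Notation RPJw := (fun w : word => RPJ R (size w) : lmodType R).

(* A formal series is a pair (x, F) with F fixed: it is encoded by its first
   component, F being a parameter of the type.  The line spanned by w in the
   summand (R P(N^l(w)) / J_l(w)) (x) w is left implicit. *)
Definition formal_series (F : posnat -> nat -> R) := dsum RPJw.

HB.instance Definition _ F := GRing.Lmodule.on (formal_series F).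

Variable F : posnat -> nat -> R.

(* A (x) w x F *)
Definition fs_term (w : word) (A : subsets (size w)) : formal_series F :=
  @dsum_single _ _ RPJw w (RPJ_class << A >>).

Definition decreasing (r : nat) (n : r.-tuple nat) : Prop :=
  (forall i : 'I_r, (1 <= tnth n i)%N) /\
  (forall i j : 'I_r, (i < j)%N -> (tnth n j < tnth n i)%N).

Definition chains (r : nat) : subsets r := [set n | decreasing n]%classic.
Arguments chains r : clear implicits.

(* For the empty word the subset of N^0 is the empty one, not the point. *)
Definition nested_fs (w : word) : formal_series F :=
  fs_term (if w is [::] then set0 else chains (size w)).

Definition nested_span : {pred formal_series F} := fun x =>
  `[< exists c : {malg R[word]}, x = lin_ext nested_fs c >].

Fact nested_span_submod : submod_closed nested_span.
Proof.
split=> [|a x y /asboolP[c ->] /asboolP[c' ->]]; apply/asboolP.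
  by exists 0; rewrite linear0.
by exists (a *: c + c'); rewrite linearP.
Qed.

HB.instance Definition _ :=
  GRing.isSubmodClosed.Build R (formal_series F) nested_span nested_span_submod.

Definition nested_series := {x : formal_series F | nested_span x}.

HB.instance Definition _ := SubChoice.on nested_series.
HB.instance Definition _ := [SubChoice_isSubLmodule of nested_series by <:].

Fact nested_fs_span w : nested_span (nested_fs w).
Proof. by apply/asboolP; exists << w >>; rewrite lin_extU. Qed.

Definition nested (w : word) : nested_series :=
  exist nested_span (nested_fs w) (nested_fs_span w).

Lemma val_lin_ext_nested (c : {malg R[word]}) :
  val (lin_ext nested c) = lin_ext nested_fs c.
Proof.
by rewrite linear_sum; apply: eq_bigr => w _; rewrite linearZ.
Qed.

Fact nested_coord_subproof (x : nested_series) :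
  exists c : {malg R[word]}, lin_ext nested c = x.
Proof.
have /asboolP[c xE] := valP x.
by exists c; apply: val_inj; rewrite val_lin_ext_nested.
Qed.

(* Coordinates in the basis [nested]; see [nested_coordK], [nestedK]. *)
Definition nested_coord (x : nested_series) : {malg R[word]} :=
  sval (cid (nested_coord_subproof x)).

Lemma nestedK x : lin_ext nested (nested_coord x) = x.
Proof. by rewrite /nested_coord; case: cid. Qed.

Definition RPJ_mass d (q : RPJ R d) : R := total_mass (repr q).

Lemma RPJ_mass_class d (x : {malg R[subsets d]}) :
  RPJ_mass (RPJ_class x) = total_mass x.
Proof.
apply/eqP; rewrite -subr_eq0 -rmorphB; apply/eqP/total_mass_Jd.
by rewrite -RPJ_eq /RPJ_class reprK.
Qed.

Lemma RPJ_massZ d c (q : RPJ R d) : RPJ_mass (c *: q) = c * RPJ_mass q.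
Proof.
have [x ->] := RPJ_classP q.
by rewrite -linearZ !RPJ_mass_class linearZ.
Qed.

Lemma nested_fs_coord c w :
  RPJ_mass (dsum_coord w (lin_ext nested_fs c)) = c@_w.
Proof.
rewrite (@lin_extEw _ _ _ _ (w |` msupp c)%fset) ?fsubsetUr //.
rewrite raddf_sum (big_fsetD1 w) ?fset1U1 //= big1_fset => [|v].
  rewrite addr0 linearZ /= RPJ_massZ /nested_fs /fs_term dsum_singleK.
  by rewrite RPJ_mass_class total_massU mulr1.
rewrite in_fsetD1 linearZ /= => /andP[vw _] _.
by rewrite /nested_fs /fs_term dsum_single_neq ?scaler0.
Qed.

Lemma lin_ext_nested_inj : injective (lin_ext nested).
Proof.
move=> c c' /(congr1 val); rewrite !val_lin_ext_nested => e.
by apply/malgP => w; rewrite -!nested_fs_coord e.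
Qed.

Lemma nested_coordK c : nested_coord (lin_ext nested c) = c.
Proof. by apply: lin_ext_nested_inj; rewrite nestedK. Qed.

Definition nested_prec (u v : word) : nested_series :=
  qsh_prec (fun n (s : {ffun 'I_(size u + size v) -> 'I_n}) =>
    nested (qsh_word s)).

Definition nested_dot (u v : word) : nested_series :=
  qsh_dot (fun n (s : {ffun 'I_(size u + size v) -> 'I_n}) =>
    nested (qsh_word s)).

Definition nested_succ (u v : word) : nested_series :=
  qsh_succ (fun n (s : {ffun 'I_(size u + size v) -> 'I_n}) =>
    nested (qsh_word s)).

Definition FS_tridend : tridend_data R :=
  based_tridend nested nested_coord [::] nested_prec nested_dot nested_succ.

End FormalSeries.

(* [ANode t0 a t1 [:: (a2, t2); ...; (ak, tk)]] has children
   [t0, t1, t2, ..., tk], hence at least two, and the angles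
   [a, a2, ..., ak] from left to right. *)
Inductive atree : Type :=
  | ALeaf
  | ANode of atree & posnat & atree & seq (posnat * atree).

HB.instance Definition _ := gen_eqMixin atree.
HB.instance Definition _ := gen_choiceMixin atree.

Definition Ytree (n : posnat) : atree := ANode ALeaf n ALeaf [::].

(* The last case does not occur when the number of children is at least 2
   and the number of angles is one less. *)
Definition anode (children : seq atree) (angles : seq posnat) : atree :=
  match children, angles with
  | t0 :: t1 :: ts, a :: w => ANode t0 a t1 (zip w ts)
  | _, _ => ALeaf
  end.

(* The nodes v_1 (the root), ..., v_k of the rightmost branch, each given
   by the forest of its children but the rightmost one, and the word of its
   angles; the leftmost branch is similar. *)
Fixpoint right_branch (t : atree) : seq (seq atree * word) :=
  match t with
  | ALeaf => [::]
  | ANode t0 a t1 ts =>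
      (belast t0 (t1 :: unzip2 ts), a :: unzip1 ts)
      :: last (right_branch t1) [seq right_branch p.2 | p <- ts]
  end.

Fixpoint left_branch (t : atree) : seq (seq atree * word) :=
  match t with
  | ALeaf => [::]
  | ANode t0 a t1 ts => (t1 :: unzip2 ts, a :: unzip1 ts) :: left_branch t0
  end.

(* The tree sigma(t, s), for [bt] the right branch of [t] and [bs] the left
   branch of [s]. *)
Definition qsh_tree (bt bs : seq (seq atree * word)) n
    (s : {ffun 'I_(size bt + size bs) -> 'I_n}) : atree :=
  let lpart m := if left_at s m is Some i then tnth (in_tuple bt) i
                 else ([::], [::]) in
  let rpart m := if right_at s m is Some j then tnth (in_tuple bs) j
                 else ([::], [::]) in
  foldr (fun m t => anode ((lpart m).1 ++ t :: (rpart m).1)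
                          ((lpart m).2 ++ (rpart m).2))
        ALeaf (enum 'I_n).

Section AngleTrees.
Variable R : realType.
Local Notation T := {malg R[atree]}.

Definition tree_prec (t s : atree) : T :=
  qsh_prec (fun n (f : {ffun 'I_(size (right_branch t)
                                 + size (left_branch s)) -> 'I_n}) =>
    << qsh_tree f >>).

Definition tree_dot (t s : atree) : T :=
  qsh_dot (fun n (f : {ffun 'I_(size (right_branch t)
                                + size (left_branch s)) -> 'I_n}) =>
    << qsh_tree f >>).

Definition tree_succ (t s : atree) : T :=
  qsh_succ (fun n (f : {ffun 'I_(size (right_branch t)
                                 + size (left_branch s)) -> 'I_n}) =>
    << qsh_tree f >>).

Definition tree_tridend : tridend_data R :=
  based_tridend (fun t : atree => << t >> : T) id ALeaf
    tree_prec tree_dot tree_succ.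

End AngleTrees.

(* [VNode n t0 t1 ts] has the children [t0, t1] and [ts], hence
   [(size ts).+1] angles. *)
Inductive vtree : Type :=
  | VLeaf
  | VNode of posnat & vtree & vtree & seq vtree.

HB.instance Definition _ := gen_eqMixin vtree.
HB.instance Definition _ := gen_choiceMixin vtree.

Fixpoint well_decorated (t : vtree) : bool :=
  match t with
  | VLeaf => true
  | VNode n t0 t1 ts => [&& (size ts).+1 <= val n, well_decorated t0,
                            well_decorated t1 & all well_decorated ts]%N
  end.

Definition dtree := {t : vtree | well_decorated t}.

HB.instance Definition _ := Choice.on dtree.

Fixpoint iota_vtree (t : atree) : vtree :=
  match t with
  | ALeaf => VLeaf
  | ANode t0 a t1 ts =>
      VNode (psum a (unzip1 ts)) (iota_vtree t0) (iota_vtree t1)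
        [seq iota_vtree p.2 | p <- ts]
  end.

Fact iota_well_decorated : forall t, well_decorated (iota_vtree t).
Proof.
fix IH 1 => t; case: t => [|t0 a t1 ts]; first exact: isT.
rewrite /= !IH /= size_map -[size ts](size_map fst) leq_size_psum /=.
elim: ts => [|p ts IHts]; first exact: isT.
by rewrite /= IH IHts.
Qed.

Definition iota_tree (t : atree) : dtree :=
  exist (fun t => is_true (well_decorated t)) (iota_vtree t)
    (iota_well_decorated t).

Section Maps.
Variable R : realType.

Fixpoint flat_vtree (t : vtree) : {malg R[word]} :=
  match t with
  | VLeaf => << [::] : word >>
  | VNode n t0 t1 ts =>
      wcons n (foldr (@star R) << [::] : word >>
                 [:: flat_vtree t0, flat_vtree t1 & map flat_vtree ts])
  end.

Definition flat : {malg R[dtree]} -> {malg R[word]} :=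
  lin_ext (fun t => flat_vtree (val t)).

HB.instance Definition _ := GRing.Linear.on flat.

(* The map iota; the name [iota] is taken by [seq.iota]. *)
Definition iotaT : {malg R[atree]} -> {malg R[dtree]} :=
  lin_ext (fun t => << iota_tree t >>).

HB.instance Definition _ := GRing.Linear.on iotaT.

Definition zetaFS : {malg R[word]} -> nested_series (@inv_pow R) :=
  lin_ext (nested (@inv_pow R)).

HB.instance Definition _ := GRing.Linear.on zetaFS.

End Maps.

(* Main.v *)
Require Import Defs.
From mathcomp Require Import all_boot all_order all_algebra reals zify.
From mathcomp.multinomials Require Import monalg.

(* A tridendriform morphism out of the tree algebra is determined by its values
   on the [Ytree n], because every tree is obtained from them by
   - [t > Y_a], the corolla at [a] with [t] grafted on its left leaf,
   - [(t0 > Y_a) < t1], which grafts [t1] on the remaining leaf, and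
   - [(t0 > Y_a) . s], which adds [t0] and the angle [a] at the left of the
     root of [s],
   all three sums over quasi-shuffles being reduced to one term.  On words
   these operations are [a x], [(a x) < y = a (x * y)] and
   [(a x) . (b y) = (a + b) (x * y)]; the same recursion defines flat o iota.
   For the second triangle, a quasi-shuffle sigma is encoded by the list telling
   for each level whether it is reached by the first and by the second block.
   Removing the head of the list is the recursion defining the quasi-shuffle of
   words, so zeta_FS transports the three products and is a morphism. *)

Set Implicit Arguments.
Unset Strict Implicit.
Unset Printing Implicit Defensive.

Import GRing.Theory.

(** * Quasi-shuffles as lists of levels *)

(* The m-th entry of a code tells whether m is in the image of the first and of
   the second block. *)
Fixpoint qsh_codes (k : nat) : nat -> seq (seq (bool * bool)) :=
  match k with
  | 0 => fun l => [:: nseq l (false, true)]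
  | k'.+1 => fix qsh_codes_k (l : nat) :=
      match l with
      | 0 => [:: nseq k (true, false)]
      | l'.+1 => map (cons (true, false)) (qsh_codes k' l)
                 ++ map (cons (false, true)) (qsh_codes_k l')
                 ++ map (cons (true, true)) (qsh_codes k' l')
      end
  end.

Lemma qsh_codesS k l : qsh_codes k.+1 l.+1 =
  map (cons (true, false)) (qsh_codes k l.+1)
  ++ map (cons (false, true)) (qsh_codes k.+1 l)
  ++ map (cons (true, true)) (qsh_codes k l).
Proof. by []. Qed.

Lemma qsh_codesk0 k : qsh_codes k 0 = [:: nseq k (true, false)].
Proof. by case: k. Qed.

Lemma mem_map_cons (T : eqType) (x y : T) (s : seq T) (S : seq (seq T)) :
  (x :: s \in map (cons y) S) = (x == y) && (s \in S).
Proof.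
apply/mapP/andP => [[s' s'S [-> ->]]|[/eqP-> sS]]; first by rewrite eqxx.
by exists s.
Qed.

(** The last condition encodes surjectivity: no level is missed by both blocks. *)
Definition is_qsh_code (k l : nat) (c : seq (bool * bool)) : bool :=
  [&& count fst c == k, count snd c == l & all (fun x => x.1 || x.2) c].

Lemma nil_map_cons (T : eqType) (y : T) (S : seq (seq T)) :
  ([::] \in map (cons y) S) = false.
Proof. by apply/mapP => -[]. Qed.

(** Induction on the code: its head decides which of the three sublists can contain it, and an
    exhausted block allows only one head. *)
Lemma mem_qsh_codes k l c : (c \in qsh_codes k l) = is_qsh_code k l c.
Proof.
elim: c k l => [|[x y] c IHc] [|k] [|l] //=.
- by rewrite !mem_cat !nil_map_cons.
- rewrite inE /is_qsh_code /=.
  by case: x y => [] [] //=; rewrite ?add1n ?andbF.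
- rewrite inE /is_qsh_code /= eqseq_cons.
  (* The comparison of the tail with the constant code is membership in a one-element list, hence an
     instance of the induction hypothesis. *)
  have := IHc 0 l; rewrite /= inE => ->.
  by case: x y => [] [] //=; rewrite ?add1n ?andbF ?add0n.
- rewrite inE eqseq_cons.
  have := IHc k 0; rewrite qsh_codesk0 inE => ->; rewrite /is_qsh_code /=.
  by case: x y => [] [] //=; rewrite ?add1n ?andbF ?add0n.
- rewrite !mem_cat !mem_map_cons -/(qsh_codes k.+1 l) !IHc /is_qsh_code /=.
  by case: x y => [] [] //=; rewrite ?add1n ?andbF ?add0n ?orbF ?eqSS.
Qed.

Lemma qsh_codes_uniq k l : uniq (qsh_codes k l).
Proof.
have consI (x : bool * bool) : injective (cons x) by move=> ? ? [].
elim: k l => [|k IHk] l; first by [].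
elim: l => [|l IHl] //.
rewrite qsh_codesS !cat_uniq !map_inj_uniq // IHl !IHk /= andbT.
apply/andP; split; apply/hasPn => -[|x c].
- by rewrite nil_map_cons.
- rewrite mem_cat !mem_map_cons negb_and => /orP[] /andP[/eqP-> _] //.
- by rewrite nil_map_cons.
- by rewrite /= !mem_map_cons => /andP[/eqP-> _].
Qed.

(** * Strictly increasing maps between finite ordinals *)

Section Increasing.
Variables (k n : nat) (f : 'I_k -> 'I_n).
Hypothesis f_incr : {homo f : i j / (i < j)%N}.

(** [left_at s] and [right_at s] are convertible to this partial inverse for the restrictions of [s]
    to its two blocks. *)
Definition preim_ord (m : 'I_n) : option 'I_k := [pick i | f i == m].

Lemma incr_inj : injective f.
Proof.
move=> i j fij; apply: val_inj => /=.
by case: (ltngtP i j) => // /f_incr; rewrite fij ltnn.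
Qed.

Lemma preim_ordK : ocancel preim_ord f.
Proof. by move=> m; rewrite /preim_ord; case: pickP => //= i /eqP. Qed.

Lemma sorted_enum_ord p : sorted (fun i j : 'I_p => i < j)%N (enum 'I_p).
Proof.
by have := iota_ltn_sorted 0 p; rewrite -val_enum_ord sorted_map.
Qed.

(** Both lists are strictly increasing and have the same elements. Hence an increasing map is
    determined by its image, which makes codes faithful. *)
Lemma map_incr_enum :
  map f (enum 'I_k) = [seq m <- enum 'I_n | preim_ord m].
Proof.
have ltn_ord_trans : transitive (fun i j : 'I_n => i < j)%N.
  by move=> j i p; exact: ltn_trans.
apply: (irr_sorted_eq ltn_ord_trans) => [i||| m]; first by rewrite /= ltnn.
- exact: (homo_sorted f_incr) (sorted_enum_ord k).
- exact: (sorted_filter ltn_ord_trans) (sorted_enum_ord n).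
rewrite mem_filter mem_enum andbT; apply/mapP/idP => [[i _ ->]|].
  by rewrite /preim_ord; case: pickP => //= /(_ i); rewrite eqxx.
by rewrite /preim_ord; case: pickP => //= i /eqP <- _;
  exists i; rewrite ?mem_enum.
Qed.

Lemma pmap_preim_ord : pmap preim_ord (enum 'I_n) = enum 'I_k.
Proof.
apply: (inj_map incr_inj).
by rewrite map_incr_enum (pmap_filter preim_ordK).
Qed.

Lemma count_preim_ord : count preim_ord (enum 'I_n) = k.
Proof. by rewrite -size_filter -map_incr_enum size_map size_enum_ord. Qed.

End Increasing.

(** Index 0 has a smaller value than every other index, so no other index can reach level 0. *)
Lemma incr_eq0 k n (f : 'I_k -> 'I_n.+1) (i : 'I_k) :
  {homo f : i j / (i < j)%N} ->
  (f i == 0 :> nat) = preim_ord f ord0 && (i == 0 :> nat).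
Proof.
move=> f_incr.
have f0 j : f j = ord0 -> j = 0 :> nat.
  case: k => [|k] in f f_incr i j *; first by case: j.
  move=> fj; apply/eqP; rewrite -leqn0 leqNgt; apply/negP => j0.
  by have := @f_incr ord0 j j0; rewrite fj.
rewrite /preim_ord; case: pickP => [j /eqP fj|f'] /=.
  apply/eqP/eqP => [fi|i0]; first exact/f0/val_inj.
  by rewrite (_ : i = j) ?fj //; apply: val_inj; rewrite /= i0 (f0 j fj).
exact: negbTE (negbT (f' i)).
Qed.

(** * The bijection between quasi-shuffles and codes *)

Section Cells.
Variables (k l : nat).

Definition qsh_code n (s : {ffun 'I_(k + l) -> 'I_n}) : seq (bool * bool) :=
  [seq (isSome (left_at s m), isSome (right_at s m)) | m <- enum 'I_n].

Lemma is_qshP n (s : {ffun 'I_(k + l) -> 'I_n}) :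
  reflect [/\ {homo (fun i : 'I_k => s (lshift l i)) : i j / (i < j)%N},
              {homo (fun j : 'I_l => s (rshift k j)) : i j / (i < j)%N}
            & forall m, left_at s m || right_at s m] (is_qsh s).
Proof.
apply: (iffP and3P) => [[/forallP sS /forallP sL /forallP sR]|[sL sR sS]].
  split=> [i j|i j|m].
  - by move/forallP: (sL i) => /(_ j) /implyP.
  - by move/forallP: (sR i) => /(_ j) /implyP.
  - have /existsP[i /eqP <-] := sS m.
    rewrite /left_at /right_at; case: (split_ordP i) => j ->.
      by case: pickP => //= /(_ j); rewrite eqxx.
    by rewrite orbC; case: pickP => //= /(_ j); rewrite eqxx.
split; apply/forallP => i; first 1 last.
- by apply/forallP => j; apply/implyP/sL.
- by apply/forallP => j; apply/implyP/sR.
apply/existsP; case/orP: (sS i); rewrite /left_at /right_at;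
  by case: pickP => // j sj _; eexists; exact: sj.
Qed.

Lemma qsh_code_is n (s : {ffun 'I_(k + l) -> 'I_n}) :
  is_qsh s -> is_qsh_code k l (qsh_code s).
Proof.
case/is_qshP=> sL sR sS.
apply/and3P; split.
- by apply/eqP; rewrite count_map; exact: (count_preim_ord sL).
- by apply/eqP; rewrite count_map; exact: (count_preim_ord sR).
- by rewrite all_map; apply/allP => m _; exact: sS.
Qed.

Lemma qsh_code_inj n : {in @is_qsh k l n &, injective (@qsh_code n)}.
Proof.
move=> s t /is_qshP[sL sR _] /is_qshP[tL tR _] /eq_in_map est.
apply/ffunP => i; case: (split_ordP i) => j ->.
  have : map (fun i => s (lshift l i)) (enum 'I_k)
         = map (fun i => t (lshift l i)) (enum 'I_k).
    rewrite (map_incr_enum sL) (map_incr_enum tL).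
    by apply: eq_in_filter => m /est[].
  by move/eq_in_map; apply; rewrite mem_enum.
have : map (fun i => s (rshift k i)) (enum 'I_l)
       = map (fun i => t (rshift k i)) (enum 'I_l).
  rewrite (map_incr_enum sR) (map_incr_enum tR).
  by apply: eq_in_filter => m /est[].
by move/eq_in_map; apply; rewrite mem_enum.
Qed.

(** The map lists in order the levels selected by [b]. *)
Lemma incr_of_mask p n (b : pred 'I_n) : count b (enum 'I_n) = p ->
  exists2 f : 'I_p -> 'I_n, {homo f : i j / (i < j)%N} &
    forall m, isSome (preim_ord f m) = b m.
Proof.
move=> bp; have szb : size (filter b (enum 'I_n)) == p.
  by rewrite size_filter bp.
exists (tnth (Tuple szb)).
  move=> i j ij; have := sorted_enum_ord n.
  have ltn_ord_trans : transitive (fun i j : 'I_n => i < j)%N.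
    by move=> j' i' m; exact: ltn_trans.
  move/(sorted_filter ltn_ord_trans b)/(sorted_ltn_nth ltn_ord_trans).
  (* ['I_n] might be empty; the index [i] provides the default value for [nth]. *)
  have [x0 _] : exists x0 : 'I_n, true by exists (tnth (Tuple szb) i).
  move=> /(_ x0); rewrite !(tnth_nth x0); apply; rewrite ?inE ?(eqP szb) //.
move=> m; rewrite /preim_ord; case: pickP => [i /eqP <-|fm] /=.
  by have := mem_tnth i (Tuple szb); rewrite mem_filter => /andP[->].
apply/esym/negP => bm; have : m \in Tuple szb by rewrite mem_filter bm mem_enum.
by move/tnthP => [i mi]; have := fm i; rewrite mi eqxx.
Qed.

(** Each of the two columns of [c] is the mask of an increasing map; the two maps are glued into
    [s]. *)
Lemma qsh_code_onto n c : is_qsh_code k l c -> size c = n ->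
  exists2 s : {ffun 'I_(k + l) -> 'I_n}, is_qsh s & qsh_code s = c.
Proof.
case/and3P=> /eqP cL /eqP cR /allP c_pos szc.
pose x0 := (false, false).
have cE : c = [seq nth x0 c (val m) | m <- enum 'I_n].
  rewrite (map_comp (nth x0 c) val) val_enum_ord -szc.
  by rewrite map_nth_iota0 ?take_size.
have [f f_incr fc] : exists2 f : 'I_k -> 'I_n, {homo f : i j / (i < j)%N} &
    forall m, isSome (preim_ord f m) = (nth x0 c (val m)).1.
  apply: incr_of_mask; rewrite -cL [in RHS]cE count_map; exact: eq_count.
have [g g_incr gc] : exists2 g : 'I_l -> 'I_n, {homo g : i j / (i < j)%N} &
    forall m, isSome (preim_ord g m) = (nth x0 c (val m)).2.
  apply: incr_of_mask; rewrite -cR [in RHS]cE count_map; exact: eq_count.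
pose s : {ffun 'I_(k + l) -> 'I_n} := [ffun i : 'I_(k + l) =>
  match split i with inl i => f i | inr j => g j end].
have sL i : s (lshift l i) = f i by rewrite ffunE (unsplitK (inl i)).
have sR j : s (rshift k j) = g j by rewrite ffunE (unsplitK (inr j)).
have lE m : left_at s m = preim_ord f m by apply: eq_pick => i; rewrite sL.
have rE m : right_at s m = preim_ord g m by apply: eq_pick => j; rewrite sR.
exists s; last first.
  rewrite [RHS]cE; apply: eq_map => m.
  by rewrite lE rE fc gc -surjective_pairing.
apply/is_qshP; split=> [i j|i j|m]; rewrite ?sL ?sR; first exact: f_incr.
  exact: g_incr.
by rewrite lE rE fc gc; apply: (c_pos (nth x0 c m)); rewrite mem_nth // szc.
Qed.

(** Injectivity and surjectivity of [qsh_code], in the form that reindexes a sum over quasi-shuffles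
    with [n] levels. *)
Lemma perm_qsh_code n :
  perm_eq [seq qsh_code s | s <- enum {ffun 'I_(k + l) -> 'I_n} & is_qsh s]
          [seq c <- qsh_codes k l | size c == n].
Proof.
apply: uniq_perm; rewrite ?filter_uniq ?qsh_codes_uniq //.
  rewrite map_inj_in_uniq => [|s t]; first exact/filter_uniq/enum_uniq.
  rewrite !mem_filter => /andP[sq _] /andP[tq _]; exact: qsh_code_inj.
move=> c; rewrite mem_filter mem_qsh_codes; apply/mapP/andP => [[s]|[]].
  rewrite mem_filter => /andP[/qsh_code_is sq _] ->.
  by rewrite size_map size_enum_ord.
move=> /eqP szc /qsh_code_onto /(_ szc)[s sq <-].
by exists s => //; rewrite mem_filter sq mem_enum.
Qed.

End Cells.

(** The hypotheses let [C] select at most the first index of each block, [x] and [y] telling whether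
    it does. By [incr_eq0] only these indices can reach level 0, so the head of the code decides. *)
Lemma fibre0_qsh_code k l n (s : {ffun 'I_(k.+1 + l.+1) -> 'I_n})
    (C : pred nat) (x y : bool) :
  (forall i, i < k.+1 -> C i = x && (i == 0))%N ->
  (forall j, j < l.+1 -> C (k.+1 + j) = y && (j == 0))%N ->
  is_qsh s -> fibre0 C s = (ohead (qsh_code s) == Some (x, y)).
Proof.
move=> Cx Cy; case: n s => [|n] s; first by case: (s ord0).
case/is_qshP=> sL sR _; rewrite /qsh_code enum_ordSl /=.
rewrite -[left_at s ord0]/(preim_ord (fun i => s (lshift l.+1 i)) ord0).
rewrite -[right_at s ord0]/(preim_ord (fun j => s (rshift k.+1 j)) ord0).
have CL i : C (lshift l.+1 i) = x && (i == 0 :> nat) := Cx _ (ltn_ord i).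
have CR j : C (rshift k.+1 j) = y && (j == 0 :> nat) := Cy _ (ltn_ord j).
apply/forallP/eqP => [s0|[xE yE] i].
  have := s0 (lshift l.+1 ord0); have := s0 (rshift k.+1 ord0).
  rewrite (incr_eq0 _ sL) (incr_eq0 _ sR) CL CR.
  by rewrite !andbT => /eqP-> /eqP->.
case: (split_ordP i) => j ->.
  by rewrite (incr_eq0 _ sL) xE CL.
by rewrite (incr_eq0 _ sR) yE CR.
Qed.

(** Every level uses up at least one element of a block. Hence the bound on [n] in [qsh_sum] loses
    no code. *)
Lemma size_qsh_code k l c : is_qsh_code k l c -> (size c <= k + l)%N.
Proof.
case/and3P=> /eqP <- /eqP <-; elim: c => //= -[x y] c IHc /andP[xy /IHc].
by move: xy; case: x y => [] [] //=; lia.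
Qed.

Local Open Scope ring_scope.

Lemma qsh_sum_codes k l (C : pred nat) (x y : bool) (V : nmodType)
    (G : seq (bool * bool) -> V) :
  (forall i, i < k.+1 -> C i = x && (i == 0))%N ->
  (forall j, j < l.+1 -> C (k.+1 + j) = y && (j == 0))%N ->
  qsh_sum C (fun n (s : {ffun 'I_(k.+1 + l.+1) -> 'I_n}) => G (qsh_code s)) =
  \sum_(c <- qsh_codes k.+1 l.+1 | ohead c == Some (x, y)) G c.
Proof.
move=> Cx Cy; pose p c := ohead c == Some (x, y).
transitivity (\sum_(n < (k.+1 + l.+1).+1)
    \sum_(c <- qsh_codes k.+1 l.+1 | (size c == n) && p c) G c).
  apply: eq_bigr => n _; rewrite -[RHS]big_filter_cond.
  rewrite -(perm_big _ (perm_qsh_code _ _ _)) big_map.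
  rewrite big_filter_cond big_enum_cond /=.
  apply: eq_bigl => s; case sq: (is_qsh s) => //=.
  by rewrite (fibre0_qsh_code Cx Cy sq).
(* After the exchange each code is counted once, for [n] its length. *)
rewrite (exchange_big_dep p) /= => [|n c _ /andP[]//].
rewrite big_seq_cond [RHS]big_seq_cond; apply: eq_bigr => c /andP[cq pc].
have szc : (size c < (k.+1 + l.+1).+1)%N.
  by rewrite ltnS size_qsh_code // -mem_qsh_codes.
by rewrite (big_pred1 (Ordinal szc)) // => n; rewrite /= pc andbT eq_sym.
Qed.

(** * Sums over quasi-shuffles by recursion on the first level *)

Section Fill.
Variables (A B : Type).
Implicit Types (u : seq A) (v : seq B).

(* Puts the letters of [u] and [v], in order, at the levels marked by [c]. *)
Fixpoint fill u v (c : seq (bool * bool)) : seq (option A * option B) :=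
  if c is (x, y) :: c' then
    (if x then ohead u else None, if y then ohead v else None)
    :: fill (if x then behead u else u) (if y then behead v else v) c'
  else [::].

Lemma fill_pmap (o : seq (option A * option B)) :
  fill (pmap fst o) (pmap snd o) [seq (isSome x.1, isSome x.2) | x <- o] = o.
Proof. by elim: o => [|[[a|] [b|]] o IHo] //=; rewrite IHo. Qed.

Lemma fill_left u : fill u [::] (nseq (size u) (true, false))
  = [seq (Some a, None) | a <- u].
Proof. by elim: u => //= a u ->. Qed.

Lemma fill_right v : fill [::] v (nseq (size v) (false, true))
  = [seq (None, Some b) | b <- v].
Proof. by elim: v => //= b v ->. Qed.

(** The common source of [qsh_word] and [qsh_tree]: both are computed from the pair of letters found
    at each level. *)
Definition qsh_cells u v n (s : {ffun 'I_(size u + size v) -> 'I_n}) :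
    seq (option A * option B) :=
  [seq (omap (tnth (in_tuple u)) (left_at s m),
        omap (tnth (in_tuple v)) (right_at s m)) | m <- enum 'I_n].

Lemma pmap_omap (S T U : Type) (f : S -> option T) (g : T -> U) (s : seq S) :
  pmap (fun x => omap g (f x)) s = map g (pmap f s).
Proof. by elim: s => //= x s; case: (f x) => [y|] /= ->. Qed.

(** As [s] increases on each block, going up the levels meets the letters of [u] and of [v] in their
    order, so the marks alone locate them. *)
Lemma qsh_cellsE u v n (s : {ffun 'I_(size u + size v) -> 'I_n}) :
  is_qsh s -> qsh_cells s = fill u v (qsh_code s).
Proof.
case/is_qshP=> sL sR _; rewrite -[LHS]fill_pmap -map_comp.
have pmap_map S T U (f : T -> option U) (g : S -> T) r :
    pmap f (map g r) = pmap (fun x => f (g x)) r by elim: r => //= x r ->.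
rewrite pmap_map [in X in fill _ X]pmap_map /= !pmap_omap.
rewrite [pmap (left_at s) _](pmap_preim_ord sL).
rewrite [pmap (right_at s) _](pmap_preim_ord sR).
rewrite !map_tnth_enum /=; congr fill; apply: eq_map => m /=.
by case: left_at right_at => [?|] [?|].
Qed.

Variable V : nmodType.
Implicit Type G : seq (option A * option B) -> V.

(** The full quasi-shuffle sum, with no condition on level 0. As [G] is arbitrary, it can absorb the
    first cell in a recursion. *)
Definition qsh_fill_sum u v G : V :=
  \sum_(c <- qsh_codes (size u) (size v)) G (fill u v c).

Lemma qsh_fill_sum0v v G :
  qsh_fill_sum [::] v G = G [seq (None, Some b) | b <- v].
Proof. by rewrite /qsh_fill_sum big_seq1 fill_right. Qed.

Lemma qsh_fill_sumu0 u G :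
  qsh_fill_sum u [::] G = G [seq (Some a, None) | a <- u].
Proof. by rewrite /qsh_fill_sum qsh_codesk0 big_seq1 fill_left. Qed.

Lemma qsh_fill_sumS a u b v G : qsh_fill_sum (a :: u) (b :: v) G =
  qsh_fill_sum u (b :: v) (fun c => G ((Some a, None) :: c))
  + qsh_fill_sum (a :: u) v (fun c => G ((None, Some b) :: c))
  + qsh_fill_sum u v (fun c => G ((Some a, Some b) :: c)).
Proof.
by rewrite /qsh_fill_sum [qsh_codes _ _]qsh_codesS !big_cat !big_map /= addrA.
Qed.

Lemma eq_qsh_sum k l (C : pred nat)
    (F F' : forall n, {ffun 'I_(k + l) -> 'I_n} -> V) :
  (forall n s, is_qsh s -> F n s = F' n s) -> qsh_sum C F = qsh_sum C F'.
Proof.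
by move=> eqF; apply: eq_bigr => n _; apply: eq_bigr => s /andP[/eqF].
Qed.

(** Once the first level is fixed, what remains is an arbitrary quasi-shuffle of the remaining
    letters: of the three sublists of codes only one has the required head. The other two products
    are similar. *)
Lemma qsh_prec_cells a u b v G :
  qsh_prec (fun n (s : {ffun 'I_(size (a :: u) + size (b :: v)) -> 'I_n}) =>
    G (qsh_cells s))
  = qsh_fill_sum u (b :: v) (fun c => G ((Some a, None) :: c)).
Proof.
pose G' c := G (fill (a :: u) (b :: v) c).
transitivity (qsh_prec (fun n
    (s : {ffun 'I_(size (a :: u) + size (b :: v)) -> 'I_n}) =>
  G' (qsh_code s))).
  by apply: eq_qsh_sum => n s sq; rewrite qsh_cellsE.
rewrite /qsh_prec (@qsh_sum_codes _ _ _ true false) // qsh_codesS.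
rewrite !big_cat !big_map /= [X in _ + (X + _)]big_pred0 //.
by rewrite [X in _ + (_ + X)]big_pred0 // !addr0.
Qed.

Lemma qsh_succ_cells a u b v G :
  qsh_succ (fun n (s : {ffun 'I_(size (a :: u) + size (b :: v)) -> 'I_n}) =>
    G (qsh_cells s))
  = qsh_fill_sum (a :: u) v (fun c => G ((None, Some b) :: c)).
Proof.
pose G' c := G (fill (a :: u) (b :: v) c).
transitivity (qsh_succ (fun n
    (s : {ffun 'I_(size (a :: u) + size (b :: v)) -> 'I_n}) =>
  G' (qsh_code s))).
  by apply: eq_qsh_sum => n s sq; rewrite qsh_cellsE.
rewrite /qsh_succ (@qsh_sum_codes _ _ _ false true) => [|i|j]; last 2 first.
- by move=> /= iu; rewrite ltn_eqF.
- by rewrite /= -[X in _ == X]addn0 eqn_add2l.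
rewrite qsh_codesS !big_cat !big_map /= [X in X + _]big_pred0 // add0r.
by rewrite [X in _ + X]big_pred0 // addr0.
Qed.

Lemma qsh_dot_cells a u b v G :
  qsh_dot (fun n (s : {ffun 'I_(size (a :: u) + size (b :: v)) -> 'I_n}) =>
    G (qsh_cells s))
  = qsh_fill_sum u v (fun c => G ((Some a, Some b) :: c)).
Proof.
pose G' c := G (fill (a :: u) (b :: v) c).
transitivity (qsh_dot (fun n
    (s : {ffun 'I_(size (a :: u) + size (b :: v)) -> 'I_n}) =>
  G' (qsh_code s))).
  by apply: eq_qsh_sum => n s sq; rewrite qsh_cellsE.
rewrite /qsh_dot (@qsh_sum_codes _ _ _ true true) => [|i|j]; last 2 first.
- by move=> /= iu; rewrite (ltn_eqF iu) orbF.
- by rewrite /= -[X in _ == X]addn0 eqn_add2l.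
rewrite qsh_codesS !big_cat !big_map /= [X in X + _]big_pred0 // add0r.
by rewrite [X in X + _]big_pred0 // add0r.
Qed.

End Fill.

Lemma raddf_qsh_sum k l (U V : nmodType) (f : {additive U -> V}) (C : pred nat)
    (F : forall n, {ffun 'I_(k + l) -> 'I_n} -> U) :
  f (qsh_sum C F) = qsh_sum C (fun n s => f (F n s)).
Proof. by rewrite raddf_sum; apply: eq_bigr => n _; rewrite raddf_sum. Qed.

(** The value on the empty cell is the default of [qsh_letter], so that [qsh_word_cells] holds for
    every [s]. *)
Definition cell_letter (x : option posnat * option posnat) : posnat :=
  match x with
  | (Some a, None) => a
  | (None, Some b) => b
  | (Some a, Some b) => padd a b
  | (None, None) => pone
  end.

Lemma qsh_word_cells (u v : word) n
    (s : {ffun 'I_(size u + size v) -> 'I_n}) :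
  qsh_word s = map cell_letter (qsh_cells s).
Proof.
rewrite /qsh_word -[RHS]map_comp; apply: eq_map => m /=.
by rewrite /qsh_letter; case: left_at right_at => [?|] [?|].
Qed.

(** * Words *)

Section WordOps.
Variable R : realType.

Lemma wconsU a (w : word) : wcons a << w >> = << a :: w >> :> {malg R[word]}.
Proof. exact: lin_extU. Qed.

Lemma wcons_qsh_fill_sum a (u v : word) (g : seq _ -> word) :
  wcons a (qsh_fill_sum u v (fun c => << g c >>))
  = qsh_fill_sum u v (fun c => << a :: g c >> : {malg R[word]}).
Proof.
by rewrite /qsh_fill_sum raddf_sum; apply: eq_bigr => c _; exact: wconsU.
Qed.

(** Both sides obey the same recursion: [qsh_fill_sumS] removes the first level as [qshuffle]
    removes the first letter. *)
Lemma qshuffle_cells (u v : word) :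
  qshuffle R u v = qsh_fill_sum u v (fun c => << map cell_letter c >>).
Proof.
have emptyl (w : word) :
    [seq cell_letter c | c <- [seq (None, Some b) | b <- w]] = w.
  by rewrite -map_comp map_id.
have emptyr (w : word) :
    [seq cell_letter c | c <- [seq (Some b, None) | b <- w]] = w.
  by rewrite -map_comp map_id.
elim: u v => [|a u IHu] v; first by rewrite qsh_fill_sum0v emptyl.
elim: v => [|b v IHv]; first by rewrite qsh_fill_sumu0 emptyr.
rewrite qsh_fill_sumS -[LHS]/(wcons a (qshuffle R u (b :: v))
  + wcons b (qshuffle R (a :: u) v) + wcons (padd a b) (qshuffle R u v)).
by rewrite IHv !IHu !wcons_qsh_fill_sum.
Qed.

(** Puts the recursive product in the form of [nested_prec], so that [zetaFS] transports it term by
    term; likewise for the next two lemmas. *)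
Lemma word_prec_qsh a (u : word) b (v : word) :
  word_prec R (a :: u) (b :: v) =
  qsh_prec (fun n (s : {ffun 'I_(size (a :: u) + size (b :: v)) -> 'I_n}) =>
    << qsh_word s >>).
Proof.
under [RHS]eq_qsh_sum => n s _ do rewrite qsh_word_cells.
rewrite [RHS](qsh_prec_cells _ _ _ _ (fun c => << map cell_letter c >>)).
by rewrite [LHS]/= qshuffle_cells wcons_qsh_fill_sum.
Qed.

Lemma word_succ_qsh a (u : word) b (v : word) :
  word_succ R (a :: u) (b :: v) =
  qsh_succ (fun n (s : {ffun 'I_(size (a :: u) + size (b :: v)) -> 'I_n}) =>
    << qsh_word s >>).
Proof.
under [RHS]eq_qsh_sum => n s _ do rewrite qsh_word_cells.
rewrite [RHS](qsh_succ_cells _ _ _ _ (fun c => << map cell_letter c >>)).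
rewrite -[LHS]/(wcons b (qshuffle R (a :: u) v)).
by rewrite qshuffle_cells wcons_qsh_fill_sum.
Qed.

Lemma word_dot_qsh a (u : word) b (v : word) :
  word_dot R (a :: u) (b :: v) =
  qsh_dot (fun n (s : {ffun 'I_(size (a :: u) + size (b :: v)) -> 'I_n}) =>
    << qsh_word s >>).
Proof.
under [RHS]eq_qsh_sum => n s _ do rewrite qsh_word_cells.
rewrite [RHS](qsh_dot_cells _ _ _ _ (fun c => << map cell_letter c >>)).
by rewrite [LHS]/= qshuffle_cells wcons_qsh_fill_sum.
Qed.

End WordOps.

(** * Linear extensions *)

Section LinExtTheory.
Variables (R : realType) (B : choiceType).

Lemma eq_lin_ext (V : lmodType R) (f g : B -> V) :
  f =1 g -> lin_ext f =1 lin_ext g.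
Proof. by move=> fg x; apply: eq_bigr => b _; rewrite fg. Qed.

Lemma linear_lin_ext (V W : lmodType R) (h : {linear V -> W}) (f : B -> V) x :
  h (lin_ext f x) = lin_ext (fun b => h (f b)) x.
Proof. by rewrite linear_sum; apply: eq_bigr => b _; rewrite linearZ. Qed.

Lemma lin_ext_lin_ext (C : choiceType) (V : lmodType R) (f : C -> V)
    (h : B -> C) x :
  lin_ext f (lin_ext (fun b => << h b >>) x) = lin_ext (fun b => f (h b)) x.
Proof. by rewrite linear_lin_ext; apply: eq_lin_ext => b; exact: lin_extU. Qed.

Lemma lin_ext_linear (V : lmodType R) (f : {linear {malg R[B]} -> V}) x :
  f x = lin_ext (fun b => f << b >>) x.
Proof.
rewrite [in LHS](monalgE x) linear_sum; apply: eq_bigr => b _.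
rewrite -linearZ; congr (f _); apply/malgP => b'.
by rewrite mcoeffZ !mcoeffU mulr_natr.
Qed.

Lemma linear_malg_eq (V : lmodType R) (f g : {linear {malg R[B]} -> V}) :
  (forall b, f << b >> = g << b >>) -> f =1 g.
Proof.
move=> fg x; rewrite (lin_ext_linear f) (lin_ext_linear g).
exact: eq_lin_ext.
Qed.

Lemma linear_bilin_ext (V W : lmodType R) (h : {linear V -> W})
    (f : B -> B -> V) x y :
  h (bilin_ext f x y) = bilin_ext (fun b b' => h (f b b')) x y.
Proof.
by rewrite linear_lin_ext; apply: eq_lin_ext => b; rewrite linear_lin_ext.
Qed.

Lemma eq_bilin_ext (V : lmodType R) (f g : B -> B -> V) x y :
  f =2 g -> bilin_ext f x y = bilin_ext g x y.
Proof. by move=> fg; apply: eq_lin_ext => b; exact/eq_lin_ext/fg. Qed.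

End LinExtTheory.

(** * Trees *)

Section TreeOps.

Definition cell_node (x : option (seq atree * word) * option (seq atree * word))
    (t : atree) : atree :=
  let l := odflt ([::], [::]) x.1 in
  let r := odflt ([::], [::]) x.2 in
  anode (l.1 ++ t :: r.1) (l.2 ++ r.2).

Lemma qsh_tree_cells (bt bs : seq (seq atree * word)) n
    (s : {ffun 'I_(size bt + size bs) -> 'I_n}) :
  qsh_tree s = foldr cell_node ALeaf (qsh_cells s).
Proof.
rewrite /qsh_tree /qsh_cells foldr_map; elim: (enum 'I_n) => //= m r ->.
by rewrite /cell_node /=; move: (left_at s m) (right_at s m) => [?|] [?|].
Qed.

(** The generated principle gives no hypothesis on the subtrees stored in [ts]; here a fold along
    [ts] carries it. *)
Lemma atree_nested_ind (P : atree -> Prop) :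
  P ALeaf ->
  (forall t0 a t1 ts, P t0 -> P t1 -> foldr (fun p Q => P p.2 /\ Q) True ts ->
     P (ANode t0 a t1 ts)) ->
  forall t, P t.
Proof.
move=> Pleaf Pnode; fix IH 1 => -[|t0 a t1 ts]; first exact: Pleaf.
apply: Pnode => //; elim: ts => [|p ts IHts]; first exact: I.
by split; [exact: IH | exact: IHts].
Qed.

(* An induction following the generation of trees by the [Ytree a]: see
   [tsucc_Ytree], [tprec_corolla] and [tdot_corolla]. *)
Lemma atree_gen_ind (P : atree -> Prop) :
  P ALeaf ->
  (forall a, P (Ytree a)) ->
  (forall t a, t != ALeaf -> P t -> P (ANode t a ALeaf [::])) ->
  (forall t0 a t1, t1 != ALeaf -> P (ANode t0 a ALeaf [::]) -> P t1 ->
     P (ANode t0 a t1 [::])) ->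
  (forall t0 a t1 b t2 ts, P (ANode t0 a ALeaf [::]) ->
     P (ANode t1 b t2 ts) -> P (ANode t0 a t1 ((b, t2) :: ts))) ->
  forall t, P t.
Proof.
move=> Pleaf PY Psucc Pprec Pdot.
have Pleft t a : P t -> P (ANode t a ALeaf [::]).
  by have [->|/Psucc] := eqVneq t ALeaf; [move=> _; exact: PY | exact].
elim/atree_nested_ind => // t0 a t1 ts.
(* Children are removed from the left, so [t0], [a] and [t1] must vary. *)
elim: ts t0 a t1 => [|[b t2] ts IHts] t0 a t1 Pt0 Pt1 => [_|/= [Pt2 Pts]].
  by have [->|t1N] := eqVneq t1 ALeaf; [exact: Pleft | exact/Pprec/Pt1/Pleft].
by apply: Pdot; [exact: Pleft | exact: IHts].
Qed.

(** This is the ladder built when the other block is empty: it gives back the tree. *)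
Lemma left_branchK t :
  foldr cell_node ALeaf [seq (None, Some b) | b <- left_branch t] = t.
Proof.
elim: t => //= t0 IH0 a t1 _ ts; rewrite IH0 /cell_node /=.
by rewrite zip_unzip.
Qed.

(** Takes out of [last] the recursive calls that the definition makes on all children. *)
Lemma right_branchE t0 a t1 ts : right_branch (ANode t0 a t1 ts) =
  (belast t0 (t1 :: unzip2 ts), a :: unzip1 ts)
  :: right_branch (last t1 (unzip2 ts)).
Proof. by rewrite -last_map -map_comp. Qed.

Lemma right_branchK t :
  foldr cell_node ALeaf [seq (Some b, None) | b <- right_branch t] = t.
Proof.
elim/atree_nested_ind: t => // t0 a t1 ts _ Kt1 Kts; rewrite right_branchE /=.
(* The rightmost child is [t1] or the last tree of [ts]; walking along [ts] reaches the hypothesis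
   on it. *)
have -> : foldr cell_node ALeaf [seq (Some b, None) |
    b <- right_branch (last t1 (unzip2 ts))] = last t1 (unzip2 ts).
  elim: ts t1 Kt1 Kts => //= p ts IHts t1 _ [Kp Kts]; exact: IHts.
by rewrite /cell_node /= cats0 cats1 -lastI zip_unzip.
Qed.

Variable R : realType.
Local Notation T := (tree_tridend R).
Implicit Types t : atree.

Lemma taug_tree t : t != ALeaf -> taug (t := T) << t >>.
Proof.
move=> tN; exists << t >>; first by rewrite mcoeffU (negbTE tN).
by rewrite lin_extU.
Qed.

Lemma taug_node t0 a t1 ts : taug (t := T) << ANode t0 a t1 ts >>.
Proof. by apply: taug_tree; apply/eqP. Qed.

(** A block with a single node is exhausted once that node is placed at the root, so one term
    survives; the next two lemmas rest on the same remark. *)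
Lemma qsh_prec_tree x y bs :
  qsh_prec (fun n (s : {ffun 'I_(size [:: x] + size (y :: bs)) -> 'I_n}) =>
    << qsh_tree s >> : {malg R[atree]})
  = << cell_node (Some x, None)
         (foldr cell_node ALeaf [seq (None, Some b) | b <- y :: bs]) >>.
Proof.
under [LHS]eq_qsh_sum => n s _ do rewrite qsh_tree_cells.
rewrite [LHS](qsh_prec_cells _ _ _ _ (fun c => << foldr cell_node ALeaf c >>)).
by rewrite qsh_fill_sum0v.
Qed.

Lemma qsh_dot_tree x y bs :
  qsh_dot (fun n (s : {ffun 'I_(size [:: x] + size (y :: bs)) -> 'I_n}) =>
    << qsh_tree s >> : {malg R[atree]})
  = << cell_node (Some x, Some y)
         (foldr cell_node ALeaf [seq (None, Some b) | b <- bs]) >>.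
Proof.
under [LHS]eq_qsh_sum => n s _ do rewrite qsh_tree_cells.
rewrite [LHS](qsh_dot_cells _ _ _ _ (fun c => << foldr cell_node ALeaf c >>)).
by rewrite qsh_fill_sum0v.
Qed.

Lemma qsh_succ_tree x bt y :
  qsh_succ (fun n (s : {ffun 'I_(size (x :: bt) + size [:: y]) -> 'I_n}) =>
    << qsh_tree s >> : {malg R[atree]})
  = << cell_node (None, Some y)
         (foldr cell_node ALeaf [seq (Some b, None) | b <- x :: bt]) >>.
Proof.
under [LHS]eq_qsh_sum => n s _ do rewrite qsh_tree_cells.
rewrite [LHS](qsh_succ_cells _ _ _ _ (fun c => << foldr cell_node ALeaf c >>)).
by rewrite qsh_fill_sumu0.
Qed.

Lemma tsucc_Ytree t a : t != ALeaf ->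
  tsucc (t := T) << t >> << Ytree a >> = << ANode t a ALeaf [::] >>.
Proof.
move=> tN; rewrite [LHS]bilin_extU /aug_succ (negbTE tN).
case: eqP => [//|_]; rewrite /tree_succ; have := right_branchK t.
case: t tN => [|t0 b t1 ts _]; [by rewrite eqxx | rewrite right_branchE => tK].
by rewrite [LHS]qsh_succ_tree tK.
Qed.

Lemma tprec_corolla t0 a t1 : t1 != ALeaf ->
  tprec (t := T) << ANode t0 a ALeaf [::] >> << t1 >>
  = << ANode t0 a t1 [::] >>.
Proof.
move=> t1N; rewrite [LHS]bilin_extU /aug_prec (negbTE t1N).
case: eqP => [//|_]; rewrite /tree_prec; have := left_branchK t1.
case: t1 t1N => [|t2 b t3 ts _ tK]; first by rewrite eqxx.
(* The right branch of the corolla computes to the single node [([:: t0], [:: a])]. *)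
by rewrite [LHS]qsh_prec_tree tK.
Qed.

Lemma tdot_corolla t0 a t1 b t2 ts :
  tdot (t := T) << ANode t0 a ALeaf [::] >> << ANode t1 b t2 ts >>
  = << ANode t0 a t1 ((b, t2) :: ts) >>.
Proof.
rewrite [LHS]bilin_extU /aug_dot.
case: eqP => [//|_]; case: eqP => [//|_]; rewrite /tree_dot.
by rewrite [LHS]qsh_dot_tree left_branchK /cell_node /= zip_unzip.
Qed.

(** The uniqueness half of freeness on the [Ytree a]. *)
Lemma tridend_morphism_eq (A : tridend_data R) (f g : {linear T -> A}) :
  tridend_morphism f -> tridend_morphism g ->
  (forall a, f << Ytree a >> = g << Ytree a >>) -> f =1 g.
Proof.
move=> fM gM fgY; apply: (@linear_malg_eq R atree A f g).
elim/atree_gen_ind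
  => [|//|t a tN IHt|t0 a t1 t1N IH0 IH1|t0 a t1 b t2 ts IH0 IH1].
- by rewrite [LHS](tmorph1 fM) [RHS](tmorph1 gM).
- rewrite -(tsucc_Ytree a tN) (tmorph_succ fM) ?(tmorph_succ gM);
    by rewrite ?IHt ?fgY //; (exact: taug_node || exact: taug_tree).
- rewrite -(tprec_corolla t0 a t1N) (tmorph_prec fM) ?(tmorph_prec gM);
    by rewrite ?IH0 ?IH1 //; (exact: taug_node || exact: taug_tree).
- rewrite -tdot_corolla (tmorph_dot fM) ?(tmorph_dot gM);
    by rewrite ?IH0 ?IH1 //; (exact: taug_node || exact: taug_tree).
Qed.

End TreeOps.

(** * The two triangles *)

Section WordMorphisms.
Variable R : realType.
Local Notation W := {malg R[word]}.
Local Notation WT := (word_tridend R).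
Implicit Types x y : W.

Lemma qshuffleu0 (u : word) : qshuffle R u [::] = << u >>.
Proof. by case: u. Qed.

Lemma star_nil x : star x << [::] : word >> = x.
Proof.
rewrite [RHS](lin_ext_linear idfun); apply: eq_lin_ext => u.
by rewrite lin_extU qshuffleu0.
Qed.

Lemma tsucc_letter x a : tsucc (t := WT) x << [:: a] >> = wcons a x.
Proof.
apply: eq_lin_ext => u; rewrite lin_extU /aug_succ /=.
by case: u => [|b u] //=; rewrite wconsU.
Qed.

(** The empty word may occur in [y]: there the augmented rule for a product with the unit on the
    right agrees with [star]. *)
Lemma tprec_wcons a x y : tprec (t := WT) (wcons a x) y = wcons a (star x y).
Proof.
rewrite [LHS]lin_ext_lin_ext [RHS]linear_lin_ext; apply: eq_lin_ext => u.
rewrite linear_lin_ext; apply: eq_lin_ext => v; rewrite /aug_prec /=.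
by case: v => [|b v] //; rewrite qshuffleu0 wconsU.
Qed.

Lemma tdot_wcons a b x y :
  tdot (t := WT) (wcons a x) (wcons b y) = wcons (padd a b) (star x y).
Proof.
rewrite [LHS]lin_ext_lin_ext [RHS]linear_lin_ext; apply: eq_lin_ext => u.
by rewrite lin_ext_lin_ext linear_lin_ext; apply: eq_lin_ext => v.
Qed.

(** [psum] folds with [a] as the innermost term, so bringing it to the front takes commutativity. *)
Lemma psum_cons a b s : psum a (b :: s) = padd a (psum b s).
Proof.
have paddCA p q r : padd p (padd q r) = padd q (padd p r).
  by apply: val_inj; rewrite /= addnCA.
rewrite /psum /=; elim: s => [|c s IHs] /=; last by rewrite paddCA IHs paddCA.
by apply: val_inj; rewrite /= addnC.
Qed.

Local Notation flat_iota t := (flat_vtree R (iota_vtree t)).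

Lemma flat_iota_node t0 a t1 ts :
  flat_iota (ANode t0 a t1 ts) = wcons (psum a (unzip1 ts))
    (star (flat_iota t0) (foldr (@star R) << [::] : word >>
       [seq flat_iota t | t <- t1 :: unzip2 ts])).
Proof. by rewrite /= -!map_comp. Qed.

Lemma flat_iota_corolla t a :
  flat_iota (ANode t a ALeaf [::]) = wcons a (flat_iota t).
Proof. by rewrite flat_iota_node /= !star_nil. Qed.

Lemma tridend_morphism_eq_flat_iota (Psi : {linear tree_tridend R -> WT}) :
  tridend_morphism Psi ->
  (forall n : posnat, Psi << Ytree n >> = << [:: n] : word >>) ->
  forall t, Psi << t >> = flat_iota t.
Proof.
move=> PsiM PsiY.
elim/atree_gen_ind
  => [|a|t a tN IHt|t0 a t1 t1N IH0 IH1|t0 a t1 b t2 ts IH0 IH1].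
- exact: (tmorph1 PsiM).
- by rewrite PsiY flat_iota_corolla wconsU.
- rewrite flat_iota_corolla -(tsucc_Ytree R a tN) (tmorph_succ PsiM).
  + by rewrite PsiY IHt; exact: tsucc_letter.
  + exact: taug_tree.
  + exact: taug_node.
- rewrite flat_iota_node -(tprec_corolla R t0 a t1N) (tmorph_prec PsiM).
  + by rewrite IH0 IH1 flat_iota_corolla /= star_nil; exact: tprec_wcons.
  + exact: taug_node.
  + exact: taug_tree.
- rewrite flat_iota_node -tdot_corolla (tmorph_dot PsiM).
  + rewrite IH0 IH1 flat_iota_corolla flat_iota_node psum_cons.
    exact: tdot_wcons.
  + exact: taug_node.
  + exact: taug_node.
Qed.

Lemma zetaFS_aug_prec (u v : word) :
  zetaFS (aug_prec (fun w : word => << w >>) [::] (word_prec R) u v)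
  = aug_prec (nested (@inv_pow R)) [::] (@nested_prec R (@inv_pow R)) u v.
Proof.
rewrite /aug_prec; case: u v => [|a u] [|b v] /=; rewrite ?raddf0 //.
  exact: lin_extU.
rewrite -[LHS]/(zetaFS (word_prec R (a :: u) (b :: v))) word_prec_qsh.
rewrite [LHS]raddf_qsh_sum.
by apply: eq_qsh_sum => n s _; exact: lin_extU.
Qed.

Lemma zetaFS_aug_succ (u v : word) :
  zetaFS (aug_succ (fun w : word => << w >>) [::] (word_succ R) u v)
  = aug_succ (nested (@inv_pow R)) [::] (@nested_succ R (@inv_pow R)) u v.
Proof.
rewrite /aug_succ; case: u v => [|a u] [|b v] /=; rewrite ?raddf0 //.
  exact: lin_extU.
rewrite -[LHS]/(zetaFS (word_succ R (a :: u) (b :: v))) word_succ_qsh.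
rewrite [LHS]raddf_qsh_sum.
by apply: eq_qsh_sum => n s _; exact: lin_extU.
Qed.

Lemma zetaFS_aug_dot (u v : word) :
  zetaFS (aug_dot [::] (word_dot R) u v)
  = aug_dot [::] (@nested_dot R (@inv_pow R)) u v.
Proof.
rewrite /aug_dot; case: u v => [|a u] [|b v] /=; rewrite ?raddf0 //.
rewrite -[LHS]/(zetaFS (word_dot R (a :: u) (b :: v))) word_dot_qsh.
rewrite [LHS]raddf_qsh_sum.
by apply: eq_qsh_sum => n s _; exact: lin_extU.
Qed.

Lemma zetaFS_morphism :
  tridend_morphism (@zetaFS R : {linear WT -> FS_tridend (@inv_pow R)}).
Proof.
split.
- exact: lin_extU.
- move=> _ [c c0 ->]; exists c => //.
  by rewrite [LHS]linear_lin_ext; apply: eq_lin_ext => w; exact: lin_extU.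
(* [zetaFS x] is [lin_ext] of [nested] at [x], so its coordinates are [x] itself and the claim
   reduces to basis words. *)
- move=> x y _ _; rewrite [LHS]linear_bilin_ext /= !nested_coordK.
  exact/eq_bilin_ext/zetaFS_aug_prec.
- move=> x y _ _; rewrite [LHS]linear_bilin_ext /= !nested_coordK.
  exact/eq_bilin_ext/zetaFS_aug_dot.
- move=> x y _ _; rewrite [LHS]linear_bilin_ext /= !nested_coordK.
  exact/eq_bilin_ext/zetaFS_aug_succ.
Qed.

End WordMorphisms.

Lemma tridend_morphism_comp (R : realType) (A B C : tridend_data R)
    (g : {linear B -> C}) (f : {linear A -> B}) :
  tridend_morphism g -> tridend_morphism f -> tridend_morphism (g \o f).
Proof.
case=> g1 gA gp gd gs [f1 fA fp fd fs].
split=> [|x /fA/gA//|x y xA yA|x y xA yA|x y xA yA] /=.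
- by rewrite f1.
- by rewrite fp // gp //; exact: fA.
- by rewrite fd // gd //; exact: fA.
- by rewrite fs // gs //; exact: fA.
Qed.

Theorem theorem4p10 (R : realType)
  (Psi : {linear tree_tridend R -> word_tridend R})
  (Psi_morph : tridend_morphism Psi)
  (PsiY : forall n : posnat, Psi << Ytree n >> = << [:: n] : word >>)
  (zetaTri : {linear tree_tridend R -> FS_tridend (@inv_pow R)})
  (zetaTri_morph : tridend_morphism zetaTri)
  (zetaTriY : forall n : posnat,
     zetaTri << Ytree n >> = nested (@inv_pow R) [:: n]) :
  @flat R \o @iotaT R =1 Psi /\ @zetaFS R \o Psi =1 zetaTri.
Proof.
split.
  apply: (@linear_malg_eq R atree _ (@flat R \o @iotaT R) Psi) => t.
  rewrite (tridend_morphism_eq_flat_iota Psi_morph PsiY) /= /iotaT lin_extU.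
  exact: lin_extU.
(* Both sides are morphisms, so comparing them on the [Ytree n] suffices. *)
apply: (@tridend_morphism_eq R (FS_tridend (@inv_pow R)) (@zetaFS R \o Psi)
  zetaTri) => //.
  exact: tridend_morphism_comp (zetaFS_morphism R) Psi_morph.
by move=> n; rewrite zetaTriY /= PsiY; exact: lin_extU.
Qed.
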